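(* The graph $G(\mathbb{Z}_m)$ is weakly perfect for every integer $m\geq 2$.
   Context: $\mathbb{Z}_m$ denotes the ring of integers modulo $m$. $G(\mathbb{Z}_m)$ is the intersection graph of ideals of $\mathbb{Z}_m$: the (simple) graph whose vertices are the non-trivial ideals of $\mathbb{Z}_m$ (ideals different from $0$ and $\mathbb{Z}_m$), where two distinct vertices $I$ and $J$ are adjacent if and only if $I\cap J\neq 0$. A graph $G$ is weakly perfect if $\chi(G)=\omega(G)$, where $\chi$ is the chromatic number and $\omega$ the clique number (number of vertices in a largest clique); both are $0$ for a graph with no vertices. *)

(* Defs.v *)
From HB Require Import structures.
From mathcomp Require Import all_boot all_order all_algebra.

Set Implicit Arguments.
Unset Strict Implicit.
Unset Printing Implicit Defensive.

Import GRing.Theory.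
Local Open Scope ring_scope.

Record sgraph := SGraph {
  vertex :> finType;
  adj : rel vertex;
  adj_sym : symmetric adj;
  adj_irrefl : irreflexive adj
}.

Definition clique (G : sgraph) (A : {set G}) : bool :=
  [forall x in A, forall y in A, (x != y) ==> adj x y].

Definition clique_number (G : sgraph) : nat :=
  (\max_(A : {set G} | clique A) #|A|)%N.

Definition proper_coloring (G : sgraph) (k : nat) (f : {ffun G -> 'I_k}) : bool :=
  [forall x, forall y, adj x y ==> (f x != f y)].

Definition colorable (G : sgraph) (k : nat) : bool :=
  [exists f : {ffun G -> 'I_k}, proper_coloring f].

Lemma ex_colorable (G : sgraph) : exists k, colorable G k.
Proof.
exists #|G|; apply/existsP; exists [ffun x => enum_rank x].
apply/forallP => x; apply/forallP => y; apply/implyP => xy; rewrite !ffunE.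
by apply: contraTneq xy => /enum_rank_inj->; rewrite adj_irrefl.
Qed.

Definition chromatic_number (G : sgraph) : nat := ex_minn (ex_colorable G).

Definition weakly_perfect (G : sgraph) : Prop :=
  chromatic_number G = clique_number G.

Definition is_ideal (R : finComNzRingType) (I : {set R}) : bool :=
  [&& 0 \in I,
      [forall x in I, forall y in I, x + y \in I]
    & [forall a : R, forall x in I, a * x \in I]].

Definition nontrivial_ideal (R : finComNzRingType) (I : {set R}) : bool :=
  [&& is_ideal I, I != [set 0] & I != [set: R]].

(* The library's idealr_closed excludes the unit ideal. *)
Lemma proper_idealP (R : finComNzRingType) (I : {set R}) :
  reflect (idealr_closed I) (is_ideal I && (I != [set: R])).
Proof.
apply: (iffP andP) => [[/and3P[I0 /forall_inP ID /forallP IM] IT]|[I0 I1 IL]].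
  have {}ID x y : x \in I -> y \in I -> x + y \in I.
    by move=> xI yI; move/forall_inP: (ID x xI); apply.
  have {}IM a x : x \in I -> a * x \in I.
    by move=> xI; move/forall_inP: (IM a); apply.
  split=> // [|a x y xI yI]; last by rewrite ID ?IM.
  apply: contra IT => I1; apply/eqP/setP => x.
  by rewrite inE -[x]mulr1 IM.
split; last by apply: contraNneq I1 => ->; rewrite inE.
apply/and3P; split=> //.
  apply/forall_inP => x xI; apply/forall_inP => y yI.
  by rewrite -[x]mul1r IL.
apply/forallP => a; apply/forall_inP => x xI.
by rewrite -[_ * _]addr0 IL.
Qed.

Definition ideal_vertex (R : finComNzRingType) : finType :=
  {I : {set R} | nontrivial_ideal I}.

Definition ideal_adj (R : finComNzRingType) : rel (ideal_vertex R) :=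
  fun I J => (I != J) && (val I :&: val J != [set 0]).

Lemma ideal_adj_sym (R : finComNzRingType) : symmetric (@ideal_adj R).
Proof. by move=> I J; rewrite /ideal_adj eq_sym setIC. Qed.

Lemma ideal_adj_irrefl (R : finComNzRingType) : irreflexive (@ideal_adj R).
Proof. by move=> I; rewrite /ideal_adj eqxx. Qed.

Definition ideal_intersection_graph (R : finComNzRingType) : sgraph :=
  SGraph (@ideal_adj_sym R) (@ideal_adj_irrefl R).

(* Main.v *)
(* An ideal of Z/m is determined by its order, a divisor of m, and two ideals
   meet in 0 iff their orders are coprime. Hence adjacency depends only on the
   set of primes dividing the order, and the ideals fall into fibers indexed by
   sets of primes of m. Choosing the larger of the fibers over B and ~: B, with
   ties broken by membership of a fixed prime, yields a clique, because fibers
   grow with B. The ideals of the other fiber can reuse its colours. *)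
Require Import Defs.
From mathcomp Require Import all_boot all_order all_algebra.
From mathcomp Require Import all_fingroup all_solvable.

Set Implicit Arguments.
Unset Strict Implicit.
Unset Printing Implicit Defensive.

(** * Cliques, colourings and supports of vertices *)

(** Every proper colouring is injective on cliques, which bounds the chromatic number below.
    Conversely [f] is itself a proper colouring, with the vertices of the clique [A] as colours. *)
Lemma weakly_perfect_retract (G : sgraph) (A : {set G}) (f : G -> G) :
  clique A -> (forall x, f x \in A) -> (forall x y, adj x y -> f x != f y) ->
  weakly_perfect G.
Proof.
move=> clA fA fP; rewrite /weakly_perfect /chromatic_number.
case: ex_minnP => k /existsP[g gP] kmin; apply/eqP; rewrite eqn_leq.
apply/andP; split; last first.
  apply/bigmax_leqP => B clB.
  have ginj : {in B &, injective g}.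
    move=> x y xB yB gxy; apply/eqP; apply: contraTT isT => xy.
    have /forall_inP/(_ y yB)/implyP/(_ xy) axy := forall_inP clB x xB.
    by have /implyP/(_ axy) := forallP (forallP gP x) y; rewrite gxy eqxx.
  by rewrite -(card_in_imset ginj) -[k in (_ <= k)%N]card_ord max_card.
have le_A : #|A| <= clique_number G by exact: leq_bigmax_cond clA.
apply: leq_trans le_A; apply: kmin; apply/existsP.
exists [ffun x => enum_rank_in (fA x) (f x)].
apply/forallP => x; apply/forallP => y; apply/implyP => xy; rewrite !ffunE.
apply: contra (fP x y xy) => /eqP/(congr1 enum_val).
by rewrite !enum_rankK_in // => ->.
Qed.

Section Support.

Variables (G : sgraph) (P : finType) (T : G -> {set P}).

Definition fiber (B : {set P}) : {set G} := [set x | T x == B].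

(* Complementary fibers are independent of each other, so one colour class per
   vertex of the larger one suffices for both. The case C = setT is excluded
   because the whole ring is not a vertex, so monotonicity may fail there. *)
Lemma weakly_perfect_support (p0 : P) :
  (forall x, T x != set0) ->
  (forall x y, adj x y = (x != y) && (T x :&: T y != set0)) ->
  (forall B C : {set P}, B \subset C -> C != setT ->
     #|fiber B| <= #|fiber C|) ->
  weakly_perfect G.
Proof.
move=> T0 adjE Tmono.
pose c B := #|fiber B|.
pose sel B := if c (~: B) == c B then p0 \in B else c (~: B) < c B.
have selN B : sel (~: B) = ~~ sel B.
  rewrite /sel setCK eq_sym; case: eqP => [_|/eqP]; first by rewrite inE.
  by case: ltngtP.
have sel_le B : sel B -> c (~: B) <= c B.
  by rewrite /sel; case: eqP => [->//|_ /ltnW].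
have tie B : sel B -> c (~: B) = c B -> p0 \in B.
  by rewrite /sel => + e; rewrite e eqxx.
have TC x : ~: T x != setT by rewrite -setC0 (inj_eq (@setC_inj _)).
(* The k-th vertex of a fiber goes to the k-th vertex of the complementary one. By [hlt] the default
   [x] is never reached when [T x] is not selected. *)
pose h x := nth x (enum (fiber (~: T x))) (index x (enum (fiber (T x)))).
have fiberT x : x \in enum (fiber (T x)) by rewrite mem_enum inE.
have hlt x : ~~ sel (T x) ->
    index x (enum (fiber (T x))) < size (enum (fiber (~: T x))).
  rewrite -selN => /sel_le; rewrite setCK /c => le_c.
  by rewrite -cardE; apply: leq_trans le_c; rewrite cardE index_mem.
have Th x : ~~ sel (T x) -> T (h x) = ~: T x.
  by move=> /hlt/(mem_nth x); rewrite mem_enum inE => /eqP.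
apply: (@weakly_perfect_retract _ [set x | sel (T x)]
          (fun x => if sel (T x) then x else h x)).
- apply/forall_inP => x; rewrite inE => sx.
  apply/forall_inP => y; rewrite inE => sy; apply/implyP => xy.
  rewrite adjE xy; apply/negP => /eqP/eqP; rewrite setI_eq0 => dxy.
  (* Disjoint selected supports give the cycle [c (T y) <= c (~: T x) <= c (T x) <= c (~: T y) <= c
     (T y)]. All are equal, so both selections are ties and [p0] lies in both supports. *)
  have le1 : c (T y) <= c (~: T x).
    by apply: Tmono; rewrite // -disjoints_subset disjoint_sym.
  have le2 : c (T x) <= c (~: T y).
    by apply: Tmono; rewrite // -disjoints_subset.
  have le3 := sel_le _ sx; have le4 := sel_le _ sy.
  have ex : c (~: T x) = c (T x).
    by apply/eqP; rewrite eqn_leq le3 (leq_trans le2) // (leq_trans le4).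
  have ey : c (~: T y) = c (T y).
    by apply/eqP; rewrite eqn_leq le4 (leq_trans le1) // (leq_trans le3).
  by move: (disjointFr dxy (tie _ sx ex)); rewrite (tie _ sy ey).
- by move=> x; case: ifPn => [|sx]; rewrite inE // Th // selN.
move=> x y; rewrite adjE => /andP[xy Txy].
(* A reused colour comes from the complementary support, hence from a non-neighbour. *)
have swap u v : ~~ sel (T v) -> u = h v -> T u :&: T v = set0.
  by move=> sv ->; rewrite Th // setIC setICr.
case: ifPn => sx; case: ifPn => sy //; apply: contra Txy => /eqP e.
- by rewrite (swap x y).
- by rewrite setIC (swap y x).
(* With both vertices recoloured, equal images force equal supports, and [h] is injective on a
   single fiber. *)
have Te : T x = T y by apply: setC_inj; rewrite -!Th // e.
case/eqP: xy; have := hlt y sy; have := fiberT y; move: e; rewrite /h -Te.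
move=> e yT lty; move/eqP: e; rewrite (set_nth_default x y) //.
by rewrite nth_uniq ?enum_uniq ?hlt // => /eqP/index_inj; apply.
Qed.

End Support.

(** * Divisors and ideals of Z/m *)

(** Induction on [D] with [e] general: a prime of [D] is coprime to [e], so it can be absorbed into
    [e], and by injectivity of [v] the remaining primes do not divide the new [e]. *)
Lemma prod_primes_dvd (I : finType) (v : I -> nat) (D : {set I}) (e n : nat) :
  injective v -> e %| n ->
  (forall i, i \in D -> [&& prime (v i), v i %| n & ~~ (v i %| e)]) ->
  e * \prod_(i in D) v i %| n.
Proof.
move=> v_inj; move eqk: #|D| => k; elim: k => [|k IHk] in D e eqk *.
  by move/eqP: eqk; rewrite cards_eq0 => /eqP-> en _; rewrite big_set0 muln1.
move=> en DP; have /card_gt0P[i iD] : 0 < #|D| by rewrite eqk.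
have /and3P[pi vn ve] := DP i iD.
rewrite (big_setD1 i iD) /= mulnA; apply: IHk.
- by move: eqk; rewrite (cardsD1 i) iD => -[].
- by rewrite Gauss_dvd ?en // coprime_sym prime_coprime.
move=> j; rewrite !inE => /andP[ji /DP/and3P[pj -> vje]]; rewrite pj.
by rewrite Euclid_dvdM // negb_or vje dvdn_prime2 // (inj_eq v_inj).
Qed.

Section ZpIdeals.

Variable n : nat.
Notation Z := 'Z_(n.+2).
Implicit Types (I J : {set Z}).

(** Multiplication by [a] is repeated addition, so the theory of subgroups of a cyclic group applies
    to ideals. *)
Lemma is_ideal_group (G : {group Z}) : is_ideal (G : {set Z}).
Proof.
apply/and3P; split; first exact: group1.
  by apply/forall_inP => x xG; apply/forall_inP => y yG; exact: (groupM xG yG).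
apply/forallP => a; apply/forall_inP => x xG.
rewrite -[a]natr_Zp GRing.mulr_natl -FinRing.zmodXgE.
by apply: groupX.
Qed.

Lemma ideal_is_group I : is_ideal I -> exists G : {group Z}, I = G.
Proof.
case/and3P=> I0 /forall_inP ID _.
have gI : group_set I.
  apply/group_setP; split=> // x y xI yI.
  by have /forall_inP := ID x xI; apply.
by exists (Group gI).
Qed.

Lemma Zp_setT_cyclic : cyclic [set: Z].
Proof. by apply/cyclicP; exists Zp1; exact: Zp_cycle. Qed.

Lemma ideal_card_inj I J : is_ideal I -> is_ideal J -> #|I| = #|J| -> I = J.
Proof.
case/ideal_is_group=> G -> /ideal_is_group[H ->] /eqP.
by rewrite -(eq_subG_cyclic Zp_setT_cyclic) ?subsetT // => /eqP->.
Qed.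

(** If the intersection is trivial, the two subgroups form a direct product inside a cyclic group;
    this product is cyclic, which forces coprime orders. *)
Lemma ideal_capP I J : is_ideal I -> is_ideal J ->
  (I :&: J == [set 0%R]) = coprime #|I| #|J|.
Proof.
case/ideal_is_group=> G -> /ideal_is_group[H ->].
apply/eqP/idP => [GH1|]; last exact: coprime_TIg.
have cGH : (H \subset 'C(G))%g.
  by apply: (sub_abelian_cent2 (cyclic_abelian Zp_setT_cyclic)); exact: subsetT.
have dGH : (G \x H = (G * H)%G)%g by rewrite dprodEY.
by rewrite -(cyclic_dprod dGH) ?(cyclicS (subsetT _) Zp_setT_cyclic).
Qed.

Lemma ideal_of_card e : e %| n.+2 -> exists2 I : {set Z}, is_ideal I & #|I| = e.
Proof.
move=> en; have e_gt0 : 0 < e by apply: dvdn_gt0 en.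
exists (<[Zp1 ^+ (n.+2 %/ e)]>%g : {set Z}); first exact: is_ideal_group.
rewrite -[LHS]/#[_]%g orderXdiv order_Zp1 ?divnA ?mulKn //.
by apply/dvdnP; exists e; rewrite mulnC divnK.
Qed.

Local Notation IG := (ideal_intersection_graph Z).

Definition order_of (x : IG) : nat := #|val x|.

Lemma order_ofP (x : IG) :
  [/\ is_ideal (val x), 1 < order_of x & order_of x < n.+2].
Proof.
have /and3P[xI x0 xT] := valP x; split=> //.
  have id0 : is_ideal [set 0%R : Z] by exact: (is_ideal_group 1%G).
  rewrite /order_of ltn_neqAle eq_sym card_gt0; apply/andP; split; last first.
    by apply/set0Pn; exists 0%R; case/and3P: xI.
  by apply: contra x0 => /eqP e1; rewrite (ideal_card_inj xI id0) // cards1.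
have idT : is_ideal [set: Z] by exact: (is_ideal_group [set: Z]%G).
rewrite /order_of ltn_neqAle -[X in _ <= X]card_ord max_card andbT.
apply: contra xT => /eqP e1; rewrite (ideal_card_inj xI idT) //.
by rewrite cardsT card_ord.
Qed.

Lemma order_of_dvd (x : IG) : order_of x %| n.+2.
Proof.
have [/ideal_is_group[G eG] _ _] := order_ofP x.
by have := cardSg (subsetT G); rewrite cardsT card_ord /order_of eG.
Qed.

Lemma order_of_inj : injective order_of.
Proof.
move=> x y e; have [[xI _ _] [yI _ _]] := (order_ofP x, order_ofP y).
by apply: val_inj; exact: ideal_card_inj.
Qed.

Lemma order_of_surj e : 1 < e < n.+2 -> e %| n.+2 -> exists x, order_of x = e.
Proof.
case/andP=> e1 en /ideal_of_card[I idI cI].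
have ntI : nontrivial_ideal I.
  rewrite /nontrivial_ideal idI /=; apply/andP; split; apply/eqP => eI.
    by move: e1; rewrite -cI eI cards1.
  by move: en; rewrite -cI eI cardsT card_ord ltnn.
by exists (Sub I ntI : IG); rewrite /order_of SubK.
Qed.

Lemma adj_order_of (x y : IG) :
  adj x y = (x != y) && ~~ coprime (order_of x) (order_of y).
Proof.
have [[xI _ _] [yI _ _]] := (order_ofP x, order_ofP y).
by rewrite -ideal_capP.
Qed.

(** * Prime supports of ideals *)

Notation prime_divisor := (seq_sub (primes n.+2)).

Definition prime_support (x : IG) : {set prime_divisor} :=
  [set p | val p %| order_of x].

Lemma prime_divisorP (p : prime_divisor) : prime (val p) /\ val p %| n.+2.
Proof. by have := valP p; rewrite mem_primes => /and3P[]. Qed.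

Lemma prime_divisor_of p : prime p -> p %| n.+2 ->
  exists r : prime_divisor, val r = p.
Proof.
move=> pp pn; have pP : p \in primes n.+2 by rewrite mem_primes pp.
by exists (Sub p pP); rewrite SubK.
Qed.

Lemma prime_support_neq0 x : prime_support x != set0.
Proof.
have [_ x1 _] := order_ofP x.
have [r er] := prime_divisor_of (pdiv_prime x1)
  (dvdn_trans (pdiv_dvd _) (order_of_dvd x)).
by apply/set0Pn; exists r; rewrite inE er pdiv_dvd.
Qed.

Lemma prime_support_meet x y :
  (prime_support x :&: prime_support y != set0)
    = ~~ coprime (order_of x) (order_of y).
Proof.
have [[_ x1 _] [_ y1 _]] := (order_ofP x, order_ofP y).
rewrite coprime_has_primes ?(ltnW x1) ?(ltnW y1) // negbK.
apply/set0Pn/hasP => [[r]|[p]].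
  rewrite !inE => /andP[rx ry]; have [pr _] := prime_divisorP r.
  by exists (val r); rewrite /= mem_primes pr ltnW.
rewrite /= !mem_primes => /and3P[pp _ py] /and3P[_ _ px].
have [r er] := prime_divisor_of pp (dvdn_trans px (order_of_dvd x)).
by exists r; rewrite !inE er px.
Qed.

(* Multiplying the order by the missing primes embeds one fiber in the other;
   C != setT keeps the result a proper divisor. *)
Lemma prime_support_mono (B C : {set prime_divisor}) :
  B \subset C -> C != setT ->
  #|fiber prime_support B| <= #|fiber prime_support C|.
Proof.
move=> BC CT; pose q := \prod_(p in C :\: B) val p.
have q_gt0 : 0 < q.
  by apply: prodn_cond_gt0 => p _; have [/prime_gt0] := prime_divisorP p.
(* The factor [q] adds exactly the primes of [C :\: B] to those of [B]. *)
have dvdE x (p : prime_divisor) : prime_support x = B ->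
    (val p %| order_of x * q) = (p \in C).
  move=> xB; have [pp _] := prime_divisorP p.
  have -> : (p \in C) = (p \in B) || (p \in C :\: B).
    rewrite inE; case: (boolP (p \in B)) => //= pB.
    by rewrite (subsetP BC).
  rewrite Euclid_dvdM // -xB inE; congr (_ || _).
  rewrite Euclid_dvd_prod // big_orE xB.
  apply/existsP/idP => [[r /andP[rD]]|pD]; last by exists p; rewrite pD /=.
  have [pr _] := prime_divisorP r.
  by rewrite dvdn_prime2 // => /eqP/val_inj->.
have lift x : prime_support x = B -> exists y, order_of y == order_of x * q.
  move=> xB; have [_ x1 _] := order_ofP x.
  have xq : order_of x * q %| n.+2.
    apply: prod_primes_dvd (order_of_dvd x) _ => //; first exact: val_inj.
    move=> p; rewrite inE => /andP[pB _]; have [pp pn] := prime_divisorP p.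
    by rewrite pp pn; move: pB; rewrite -xB inE.
  have [||y ey] := @order_of_surj (order_of x * q) => //; last first.
    by exists y; apply/eqP.
  rewrite (leq_trans x1) ?leq_pmulr //= ltn_neqAle dvdn_leq // andbT.
  (* If the product were [n.+2], every prime divisor would divide it and [C] would be full. *)
  apply: contra CT => /eqP xn; apply/eqP/setP => p.
  by rewrite inE -(dvdE x) // xn; have [] := prime_divisorP p.
pose f x := odflt x [pick y | order_of y == order_of x * q].
have fE x : prime_support x = B -> order_of (f x) = order_of x * q.
  move=> /lift[y yx]; rewrite /f; case: pickP => [z /eqP//|/(_ y)].
  by rewrite yx.
have finj : {in fiber prime_support B &, injective f}.
  move=> x y; rewrite !inE => /eqP xB /eqP yB /(congr1 order_of)/eqP.
  by rewrite !fE // eqn_pmul2r // => /eqP/order_of_inj.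
rewrite -(card_in_imset finj); apply/subset_leq_card/subsetP => y.
case/imsetP=> x; rewrite !inE => /eqP xB ->; apply/eqP/setP => p.
by rewrite inE fE // dvdE.
Qed.

End ZpIdeals.

Theorem corollary2 (m : nat) (hm : (2 <= m)%N) :
  weakly_perfect (ideal_intersection_graph 'Z_m).
Proof.
case: m hm => [|[|n]] // _.
(* The least prime divisor of [n.+2] is taken as the tie-breaker. *)
have [p0 _] := prime_divisor_of (pdiv_prime (isT : 1 < n.+2)) (pdiv_dvd _).
apply: (weakly_perfect_support (T := @prime_support n) p0).
- exact: prime_support_neq0.
- by move=> x y; rewrite prime_support_meet adj_order_of.
exact: prime_support_mono.
Qed.
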